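(* Let $n\ge 2$ and consider the manifold of probability distributions on a finite set with $n+1$ elements, i.e. the open $n$-simplex $\Delta=\{(p^1,\dots,p^{n+1})\in\mathbb{R}^{n+1}: p^j>0,\ \sum_j p^j=1\}$ with vertices $\mathbf{e}_1,\dots,\mathbf{e}_{n+1}$. Then there exists an $(n+1)$-web on $\Delta$ which is parallelizable and is given by the Cevian lines of the simplex.
   Context: The vertex $\mathbf{e}_k$ is the $k$-th standard basis vector of $\mathbb{R}^{n+1}$, i.e. the probability distribution concentrated at the $k$-th element. A Cevian (Ceva line) is a line starting from a vertex $\mathbf{e}_k$ of the simplex and connecting it to the opposite face. Through each $\mathbf{p}\in\Delta$ there passes exactly one Cevian from each vertex $\mathbf{e}_k$; it meets the opposite face in the point with coordinates $q_k^i=p^i/(1-p^k)$, $i\neq k$. For fixed $k$, the Cevians issued from $\mathbf{e}_k$ are the leaves of a foliation of $\Delta$. A $d$-web on a manifold is a set of $d$ foliations in general position. Here the web consists of $n+1$ foliations by curves, each foliation being formed by the Cevians from one vertex. Such a web is parallelizable if it is equivalent, by a local diffeomorphism near each point into $\mathbb{R}^n$ taking leaves to leaves, to a web formed by $n+1$ families of parallel straight lines. *)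

(* Defs.v *)
From HB Require Import structures.
From mathcomp Require Import all_boot all_order all_algebra.
From mathcomp Require Import all_classical all_reals all_analysis.

Set Implicit Arguments.
Unset Strict Implicit.
Unset Printing Implicit Defensive.

Import Order.TTheory GRing.Theory Num.Theory.
Import numFieldNormedType.Exports.

Local Open Scope classical_set_scope.
Local Open Scope ring_scope.

(* Meaningful for an open set [A] of a finite-dimensional space [V]: the
   differentials are then of class C^k as soon as the maps x |-> df_x(v) are,
   for every fixed v. *)
Fixpoint class_C (R : realType) (V W : normedModType R) (k : nat)
    (A : set V) (f : V -> W) : Prop :=
  match k with
  | 0 => forall x, A x -> {for x, continuous f}
  | k'.+1 => (forall x, A x -> differentiable f x) /\
             (forall v : V, class_C k' A (fun x => 'D_v f x))
  end.

(* [A] is arbitrary, e.g. a submanifold of [V]: [f] is required to extend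
   locally to a C^oo map on an open set of the ambient space. The values of [f]
   outside [A] are irrelevant. *)
Definition smooth_on (R : realType) (V W : normedModType R)
    (A : set V) (f : V -> W) : Prop :=
  forall x, A x -> exists (O : set V) (g : V -> W),
    [/\ open O, O x, forall k, class_C k O g
      & forall y, A y -> O y -> g y = f y].

Definition diffeo_on (R : realType) (V W : normedModType R)
    (A : set V) (B : set W) (f : V -> W) : Prop :=
  exists g : W -> V,
    [/\ smooth_on A f, smooth_on B g,
        forall x, A x -> B (f x) /\ g (f x) = x
      & forall y, B y -> A (g y) /\ f (g y) = y].

(* Manifolds are embedded: [M] is a subset of R^m with the induced topology and
   smooth structure, and its dimension [n] is that of the target of its
   charts. *)
Definition chart (R : realType) (m n : nat) (M U : set 'rV[R]_m)
    (phi : 'rV[R]_m -> 'rV[R]_n) : Prop :=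
  [/\ exists2 O, open O & U = M `&` O,
      open (phi @` U) & diffeo_on U (phi @` U) phi].

Definition path_component (R : realType) (T : topologicalType)
    (A : set T) (x : T) : set T :=
  [set y | exists g : R -> T,
     [/\ {within `[0, 1], continuous g}, g 0 = x, g 1 = y
       & forall t : R, 0 <= t <= 1 -> A (g t)]].

(* [F] is the set of leaves. In a flat chart [phi], the (path) components of the
   traces of the leaves on the domain [U] are the plaques, i.e. the sets where
   all coordinates of [phi] but the first are constant. Path components, rather
   than connected components, are the right notion here because a leaf carries
   the topology induced by [M], which may be coarser than its intrinsic one. *)
Definition curve_foliation (R : realType) (m n : nat) (M : set 'rV[R]_m)
    (F : set (set 'rV[R]_m)) : Prop :=
  [/\ partition F id M,
      forall L, F L -> forall x y, L x -> L y -> path_component R L x y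
    & forall p, M p -> exists U (phi : 'rV[R]_m -> 'rV[R]_n),
        [/\ U p, chart M U phi
          & forall L x, F L -> (L `&` U) x ->
              path_component R (L `&` U) x =
              [set y | U y /\ forall i : 'I_n, val i != 0%N ->
                                 phi y 0 i = phi x 0 i]]].

(* Velocities at [p] of the smooth curves contained in the leaf through [p]. *)
Definition leaf_tangent (R : realType) (m : nat) (F : set (set 'rV[R]_m))
    (p v : 'rV[R]_m) : Prop :=
  exists (L : set 'rV[R]_m) (e : R) (c : R -> 'rV[R]_m),
    [/\ F L, 0 < e, smooth_on [set t : R | - e < t < e] c,
        forall t : R, - e < t < e -> L (c t)
      & c 0 = p /\ 'D_1 c 0 = v].

(* Any at most [n] of the tangent lines to the leaves through a point are
   linearly independent. *)
Definition general_position (R : realType) (m n d : nat) (M : set 'rV[R]_m)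
    (W : 'I_d -> set (set 'rV[R]_m)) : Prop :=
  forall (p : 'rV[R]_m) (v : 'I_d -> 'rV[R]_m), M p ->
    (forall k, leaf_tangent (W k) p (v k) /\ v k != 0) ->
    forall (r : nat) (s : 'I_r -> 'I_d), (r <= n)%N -> injective s ->
      row_free (\matrix_(i < r) v (s i)).

(* A [d]-web by curves on the [n]-dimensional manifold [M]. *)
Definition curve_web (R : realType) (m n d : nat) (M : set 'rV[R]_m)
    (W : 'I_d -> set (set 'rV[R]_m)) : Prop :=
  (forall k, curve_foliation n M (W k)) /\ general_position n M W.

(* Leaves of the foliation induced on an open subset [U]. *)
Definition restrict_leaves (R : realType) (m : nat) (F : set (set 'rV[R]_m))
    (U : set 'rV[R]_m) : set (set 'rV[R]_m) :=
  [set C | exists (L : set 'rV[R]_m) (x : 'rV[R]_m),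
     [/\ F L, (L `&` U) x & C = path_component R (L `&` U) x]].

Definition parallel_lines (R : realType) (n : nat) (w : 'rV[R]_n) :
    set (set 'rV[R]_n) :=
  [set [set x + t *: w | t in [set: R]] | x in [set: 'rV[R]_n]].

Definition parallelizable (R : realType) (m n d : nat) (M : set 'rV[R]_m)
    (W : 'I_d -> set (set 'rV[R]_m)) : Prop :=
  exists w : 'I_d -> 'rV[R]_n,
    curve_web n [set: 'rV[R]_n] (fun k => parallel_lines (w k)) /\
    forall p, M p -> exists U (phi : 'rV[R]_m -> 'rV[R]_n),
      [/\ U p, chart M U phi
        & forall k, [set phi @` C | C in restrict_leaves (W k) U] =
                    restrict_leaves (parallel_lines (w k)) (phi @` U)].

Definition open_simplex (R : realType) (n : nat) : set 'rV[R]_n.+1 :=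
  [set p : 'rV[R]_n.+1 | (forall j, 0 < p 0 j) /\ \sum_j p 0 j = 1].
Arguments open_simplex : clear implicits.

Definition vertex (R : realType) (n : nat) (k : 'I_n.+1) : 'rV[R]_n.+1 :=
  delta_mx 0 k.

Definition opposite_face (R : realType) (n : nat) (k : 'I_n.+1) :
    set 'rV[R]_n.+1 :=
  [set q : 'rV[R]_n.+1 | [/\ forall j, 0 <= q 0 j, \sum_j q 0 j = 1 & q 0 k = 0]].

Definition cevian (R : realType) (n : nat) (k : 'I_n.+1) (q : 'rV[R]_n.+1) :
    set 'rV[R]_n.+1 :=
  [set (1 - t) *: vertex R k + t *: q | t in [set t : R | 0 <= t <= 1]].

(* Segments joining a vertex to a boundary point of the opposite face do not
   meet the open simplex, hence the nonemptiness condition. *)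
Definition cevian_leaves (R : realType) (n : nat) (k : 'I_n.+1) :
    set (set 'rV[R]_n.+1) :=
  [set L | L !=set0 /\
     exists2 q, opposite_face k q & L = cevian k q `&` open_simplex R n].
Arguments cevian_leaves : clear implicits.

(* Main.v *)
(* The log-ratio map p |-> (ln p_j - ln p_0)_(j >= 1) is a diffeomorphism of the
   open simplex onto R^n, with inverse the softmax map. Two points p, x of the
   simplex lie on the same Cevian from e_k iff their coordinates other than the
   k-th are proportional, i.e. iff ln x - ln p is a combination of e_k and of
   (1, ..., 1); since log-ratios kill (1, ..., 1), this means that their images
   lie on a common line directed by the image of e_k. Hence a single global chart
   maps the n+1 families of Cevians to n+1 families of parallel lines, and a
   linear change of coordinates turns it into a flat chart for each of them. *)

Require Import Defs.
From HB Require Import structures.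
From mathcomp Require Import all_boot all_order all_algebra.
From mathcomp Require Import all_classical all_reals all_analysis.

Set Implicit Arguments.
Unset Strict Implicit.
Unset Printing Implicit Defensive.

Import Order.TTheory GRing.Theory Num.Theory.
Import numFieldNormedType.Exports.

Local Open Scope classical_set_scope.
Local Open Scope ring_scope.

(** * Calculus of C^k maps on an open set *)

Section ClassC.
Variable R : realType.
Implicit Types (U V W : normedModType R).

(** The first-order expansion of [f] at [x] is also one of [g]; by uniqueness its linear part is the
    differential of [g]. *)
Lemma near_eq_differentiable V W (f g : V -> W) (x : V) :
  {near x, f =1 g} -> differentiable f x -> differentiable g x.
Proof.
move=> fg df; have [dfc fx] := (diff_locallyP _ _).1 df.
have gx : g \o shift x = cst (g x) + 'd f x +o_ 0 id.
  apply/eqaddoP => e e0; move/eqaddoP : fx => /(_ e e0) fe.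
  have fg0 : \forall h \near (0 : V), f (h + x) = g (h + x).
    by move: fg; rewrite (near_shift (0 : V) x) subr0.
  move: fe fg0; apply: filterS2 => h /=.
  by rewrite !fctE /= => + <-; rewrite (nbhs_singleton fg).
have dgE := diff_unique dfc gx.
by apply/diff_locallyP; rewrite dgE.
Qed.

Lemma class_CS V W k (A : set V) (f : V -> W) :
  class_C k.+1 A f -> class_C k A f.
Proof.
elim: k f => [|k IH] f /= [df Df]; first by move=> x /df /differentiable_continuous.
by split=> // v; apply/IH/Df.
Qed.

(** Used below to replace a directional derivative by a formula valid only on [A]. As [A] is open,
    equality on [A] is equality near each of its points, hence passes to derivatives. *)
Lemma eq_class_C V W k (A : set V) (f g : V -> W) : open A ->
  {in A, f =1 g} -> class_C k A f -> class_C k A g.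
Proof.
move=> oA; elim: k f g => [|k IH] f g fg.
  move=> fc x Ax; have := fc x Ax; rewrite /prop_for /continuous_at.
  rewrite fg ?inE//; apply: cvg_trans; apply: near_eq_cvg.
  by apply: filterS (open_nbhs_nbhs (conj oA Ax)) => y Ay; rewrite fg ?inE.
have nfg x : A x -> {near x, f =1 g}.
  by move=> Ax; apply: filterS (open_nbhs_nbhs (conj oA Ax)) => y Ay; rewrite fg ?inE.
move=> [df Df]; split=> [x Ax|v]; first exact: near_eq_differentiable (nfg x Ax) (df x Ax).
apply: IH (Df v) => x /[!inE] Ax; exact/near_eq_derive/nfg.
Qed.

Lemma class_C_cst V W k (A : set V) (c : W) : class_C k A (cst c).
Proof.
elim: k c => [|k IH] c /=; first by move=> x _; exact: cst_continuous.
split=> [x _|v]; first exact: differentiable_cst.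
have -> : 'D_v (cst c) = cst 0 :> (V -> W) by apply/funext => x; rewrite derive_cst.
exact: IH.
Qed.

Lemma derive_linear_comp V W W' (l : {linear W -> W'}) (f : V -> W) x v :
  continuous l -> differentiable f x -> 'D_v (l \o f) x = l ('D_v f x).
Proof.
move=> lc df; have dl : differentiable l (f x) by exact: linear_differentiable.
rewrite (deriveE v df) (deriveE v (differentiable_comp df dl)) (diff_comp df dl) /=.
by rewrite diff_lin.
Qed.

Lemma class_C_linear_comp V W W' k (A : set V) (l : {linear W -> W'})
    (f : V -> W) : open A -> continuous l -> class_C k A f -> class_C k A (l \o f).
Proof.
move=> oA lc; elim: k f => [|k IH] f.
  by move=> fc x Ax; apply: continuous_comp; [exact: fc|exact: lc].
move=> [df Df]; split=> [x Ax|v].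
  by apply: differentiable_comp (df x Ax) _; exact: linear_differentiable.
apply: eq_class_C (IH _ (Df v)) => // x /[!inE] Ax /=.
by rewrite derive_linear_comp //; exact: df.
Qed.

Lemma class_C_comp_linear V W W' k (A : set W) (l : {linear V -> W})
    (f : W -> W') : open A -> continuous l ->
  class_C k A f -> class_C k (l @^-1` A) (f \o l).
Proof.
move=> oA lc; elim: k f => [|k IH] f.
  by move=> fc x Ax; apply: continuous_comp; [exact: lc|exact: fc].
have oA' : open (l @^-1` A) by apply: open_comp => // x _; exact: lc.
have dl x : differentiable l x by exact: linear_differentiable.
move=> [df Df]; split=> [x Ax|v].
  by apply: differentiable_comp; [exact: dl|exact: df].
apply: eq_class_C (IH _ (Df (l v))) => // x /[!inE] Ax /=.
have dfl := differentiable_comp (dl x) (df _ Ax).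
by rewrite (deriveE _ (df _ Ax)) (deriveE v dfl) (diff_comp (dl x) (df _ Ax)) /= diff_lin.
Qed.

Lemma class_CD V W k (A : set V) (f g : V -> W) : open A ->
  class_C k A f -> class_C k A g -> class_C k A (f \+ g).
Proof.
move=> oA; elim: k f g => [|k IH] f g.
  by move=> fc gc x Ax; apply: continuousD; [exact: fc|exact: gc].
move=> [df Df] [dg Dg]; split=> [x Ax|v].
  by apply: differentiableD; [exact: df|exact: dg].
apply: eq_class_C (IH _ _ (Df v) (Dg v)) => // x /[!inE] Ax /=.
by rewrite deriveD //; apply: diff_derivable; [exact: df|exact: dg].
Qed.

Lemma class_C_sum V W k (A : set V) (I : Type) (r : seq I) (f : I -> V -> W) :
  open A -> (forall i, class_C k A (f i)) ->
  class_C k A (fun x => \sum_(i <- r) f i x).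
Proof.
move=> oA fC; elim: r => [|i r IH].
  have -> : (fun x => \sum_(i <- [::]) f i x) = cst 0 by apply/funext => x; rewrite big_nil.
  exact: class_C_cst.
have -> : (fun x => \sum_(j <- i :: r) f j x) = f i \+ (fun x => \sum_(j <- r) f j x).
  by apply/funext => x; rewrite big_cons.
exact: class_CD.
Qed.

Lemma class_CM V k (A : set V) (f g : V -> R) : open A ->
  class_C k A f -> class_C k A g -> class_C k A (f \* g).
Proof.
move=> oA; elim: k f g => [|k IH] f g.
  by move=> fc gc x Ax; apply: continuousM; [exact: fc|exact: gc].
move=> Cf Cg; have [[df Df] [dg Dg]] := (Cf, Cg); split=> [x Ax|v].
  by apply: differentiableM; [exact: df|exact: dg].
(* In each term of the product rule one factor is a derivative, of class C^k; the other is lowered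
   from C^(k+1) to C^k. *)
have Df' := IH _ _ (Df v) (class_CS Cg).
have Dg' := IH _ _ (class_CS Cf) (Dg v).
apply: eq_class_C (class_CD oA Df' Dg') => // x /[!inE] Ax /=.
rewrite (deriveM (diff_derivable (df x Ax)) (diff_derivable (dg x Ax))).
by rewrite /GRing.scale /= addrC [X in _ + X]mulrC.
Qed.

(** The induction step common to exponential, inverse and logarithm: by the chain rule, one more
    derivative of [h \o f] costs only the class C^k of [h' \o f]. *)
Lemma class_C_comp_derive V k (A : set V) (f : V -> R) (h h' : R -> R) : open A ->
  (forall x, A x -> is_derive (f x) 1 h (h' (f x))) ->
  class_C k A (h' \o f) -> class_C k.+1 A f -> class_C k.+1 A (h \o f).
Proof.
move=> oA dh h'C [df Df].
have dhf x : A x -> differentiable h (f x).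
  by move=> /dh ?; apply/derivable1_diffP/ex_derive.
split=> [x Ax|v]; first by apply: differentiable_comp; [exact: df|exact: dhf].
apply: eq_class_C (class_CM oA h'C (Df v)) => // x /[!inE] Ax /=.
have dhfx := differentiable_comp (df x Ax) (dhf x Ax).
rewrite (deriveE _ (df x Ax)) (deriveE v dhfx) (diff_comp (df x Ax) (dhf x Ax)) /=.
have dhx := dh x Ax.
rewrite (diff1E (dhf x Ax)) derive1E derive_val /GRing.scale /=.
by rewrite mulrC.
Qed.

Lemma class_C_comp_continuous V (A : set V) (f : V -> R) (h h' : R -> R) :
  (forall x, A x -> is_derive (f x) 1 h (h' (f x))) ->
  class_C 0 A f -> class_C 0 A (h \o f).
Proof.
move=> dh fC x Ax; apply: continuous_comp; first exact: fC.
have ? := dh x Ax.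
by apply/differentiable_continuous/derivable1_diffP/ex_derive.
Qed.

Lemma class_C_expR V k (A : set V) (f : V -> R) : open A ->
  class_C k A f -> class_C k A (expR \o f).
Proof.
move=> oA; elim: k f => [|k IH] f fC.
  exact: (class_C_comp_continuous (h' := expR) (fun _ _ => is_derive_expR _) fC).
apply: (class_C_comp_derive oA _ _ fC) => //.
exact: IH (class_CS fC).
Qed.

(** The derivative of the inverse is minus its square, so the induction closes up by [class_CM]. *)
Lemma class_CV V k (A : set V) (f : V -> R) : open A ->
  (forall x, A x -> f x != 0) -> class_C k A f -> class_C k A (GRing.inv \o f).
Proof.
move=> oA f0.
have dV x : A x -> is_derive (f x) 1 (@GRing.inv R) (- (f x)^-1 ^+ 2).
  move=> /f0 fx0; have := is_deriveV (f := id) fx0 (is_derive_id (f x) 1).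
  by rewrite /GRing.scale /= mulr1 exprVn.
elim: k => [|k IH] fC.
  exact: (class_C_comp_continuous (h' := fun y => - y^-1 ^+ 2) dV fC).
apply: (class_C_comp_derive (h' := fun y => - y^-1 ^+ 2) oA _ _ fC) => //.
have VC := IH (class_CS fC).
apply: eq_class_C (class_CM oA (@class_C_cst _ _ k A (-1 : R)) (class_CM oA VC VC)) => //.
by move=> x _ /=; rewrite mulN1r expr2.
Qed.

(** Needs no induction: one derivative turns the logarithm into the inverse, settled by
    [class_CV]. *)
Lemma class_C_ln V k (A : set V) (f : V -> R) : open A ->
  (forall x, A x -> 0 < f x) -> class_C k A f -> class_C k A (@ln R \o f).
Proof.
move=> oA f0.
have dln x : A x -> is_derive (f x) 1 (@ln R) (f x)^-1 by move=> /f0; exact: is_derive1_ln.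
case: k => [|k] fC; first exact: (class_C_comp_continuous (h' := @GRing.inv R) dln fC).
apply: (class_C_comp_derive (h' := @GRing.inv R) oA _ _ fC) => //.
by apply: class_CV (class_CS fC) => // x /f0/gt_eqF->.
Qed.

End ClassC.

(** * Smooth maps on spaces of row vectors *)

Section RowVectors.
Variable R : realType.
Implicit Types (U V W : normedModType R).

Lemma class_CZl V W k (A : set V) (f : V -> R) (c : W) : open A ->
  class_C k A f -> class_C k A (fun x => f x *: c).
Proof.
move=> oA; elim: k f => [|k IH] f.
  by move=> fc x Ax; apply: continuousZl; exact: fc.
move=> [df Df]; split=> [x Ax|v]; first exact/differentiableZl/df.
apply: eq_class_C (IH _ (Df v)) => // x /[!inE] Ax /=.
have dfc : differentiable (fun x => f x *: c) x by exact/differentiableZl/df.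
by rewrite (deriveE _ (df x Ax)) (deriveE v dfc) (diffZl c (df x Ax)).
Qed.

Lemma class_C_coord m k (A : set 'rV[R]_m) (i : 'I_m) :
  class_C k A (fun x : 'rV[R]_m => x 0 i).
Proof.
case: k => [|k]; first by move=> x _; exact: coord_continuous.
split=> [x _|v]; first exact: differentiable_coord.
have -> : 'D_v (fun x : 'rV[R]_m => x 0 i) = cst (v 0 i).
  apply/funext => x /=; have := derive_mx (@derivable_id _ _ x v).
  by rewrite derive_id => /matrixP/(_ 0 i); rewrite mxE.
exact: class_C_cst.
Qed.

Lemma class_C_row V n k (A : set V) (f : V -> 'rV[R]_n) : open A ->
  (forall i, class_C k A (fun x => f x 0 i)) -> class_C k A f.
Proof.
move=> oA fC; have -> : f = fun x => \sum_(i < n) f x 0 i *: delta_mx 0 i.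
  by apply/funext => x; exact: row_sum_delta.
by apply: class_C_sum => // i; exact: class_CZl.
Qed.

Lemma linear_rV_continuous m W (l : {linear 'rV[R]_m -> W}) : continuous l.
Proof.
have -> : (l : _ -> _) = fun x : 'rV[R]_m => \sum_(i < m) x 0 i *: l (delta_mx 0 i).
  apply/funext => x; rewrite [in LHS](row_sum_delta x) linear_sum.
  by apply: eq_bigr => i _; rewrite linearZ.
(* Continuity is [class_C 0], so the lemmas on C^k maps apply. *)
move=> x; apply: (@class_C_sum _ _ _ 0 setT) => // [|i]; first exact: openT.
by apply: class_CZl; [exact: openT|exact: class_C_coord].
Qed.

Lemma smooth_on_class_C V W (O A : set V) (f : V -> W) : open O -> A `<=` O ->
  (forall k, class_C k O f) -> smooth_on A f.
Proof. by move=> oO AO fC x Ax; exists O, f; split=> //; exact: AO. Qed.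

Lemma smooth_on_differentiable V W (A : set V) (f : V -> W) x : open A -> A x ->
  smooth_on A f -> differentiable f x.
Proof.
move=> oA Ax /(_ x Ax)[ O [g [oO Ox gC gf]]].
have [dg _] := gC 1; apply: near_eq_differentiable (dg x Ox).
apply: filterS (open_nbhs_nbhs (conj (openI oA oO) (conj Ax Ox))) => y [? ?].
exact: gf.
Qed.

Lemma smooth_on_mulmxr V m n (A : set V) (f : V -> 'rV[R]_m) (P : 'M[R]_(m, n)) :
  smooth_on A f -> smooth_on A (fun x => f x *m P).
Proof.
move=> fS x /fS[ O [g [oO Ox gC gf]]]; exists O, (mulmxr P \o g); split=> //.
  by move=> k; apply: class_C_linear_comp => //; exact: linear_rV_continuous.
by move=> y Ay Oy /=; rewrite gf.
Qed.

Lemma smooth_on_comp_mulmxr m n W (A : set 'rV[R]_n) (f : 'rV[R]_n -> W)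
    (P : 'M[R]_(m, n)) :
  smooth_on A f -> smooth_on (mulmxr P @^-1` A) (f \o mulmxr P).
Proof.
move=> fS x /fS[ O [g [oO Ox gC gf]]].
have lc : continuous (mulmxr P : 'rV_m -> 'rV_n) by exact: linear_rV_continuous.
exists (mulmxr P @^-1` O), (g \o mulmxr P); split=> //.
- by apply: open_comp => // y _; exact: lc.
- by move=> k; exact: class_C_comp_linear.
- by move=> y Ay Oy; exact: gf.
Qed.

(** Serves to turn a chart onto R^n into a flat chart by a linear change of coordinates in the
    target. *)
Lemma diffeo_on_mulmxr m n (A : set 'rV[R]_m) (phi : 'rV[R]_m -> 'rV[R]_n)
    (P : 'M[R]_n) : P \in unitmx ->
  diffeo_on A setT phi -> diffeo_on A setT (fun x => phi x *m P).
Proof.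
move=> Pu [g [phiS gS gphi phig]]; exists (g \o mulmxr (invmx P)); split.
- exact: smooth_on_mulmxr.
- by have := smooth_on_comp_mulmxr (P := invmx P) gS; rewrite preimage_setT.
- by move=> x Ax; split=> //=; rewrite mulmxK//; have [] := gphi x Ax.
- by move=> y _ /=; have [Ag ->] := phig (y *m invmx P) I; rewrite mulmxKV.
Qed.

Lemma diffeo_on_surj V W (A : set V) (B : set W) (phi : V -> W) :
  diffeo_on A B phi -> phi @` A = B.
Proof.
move=> [g [_ _ gphi phig]]; apply/seteqP; split=> [_ [x Ax <-]|y By].
  by have [] := gphi x Ax.
by have [Ag phigy] := phig y By; exists (g y).
Qed.

End RowVectors.

(** * Foliations pulled back from parallel lines, and general position *)

Section Foliations.
Variable R : realType.

(** Intersecting with [M] discards the meaningless values of [phi] outside its domain. *)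
Definition preimage_leaves m n (M : set 'rV[R]_m) (phi : 'rV[R]_m -> 'rV[R]_n)
    (F : set (set 'rV[R]_n)) : set (set 'rV[R]_m) :=
  [set M `&` phi @^-1` l | l in F].

(* The rows of the inverse of [P] form a basis whose first vector is proportional
   to [w]. *)
Lemma flattening n (w : 'rV[R]_n) : w != 0 ->
  exists2 P, P \in unitmx & forall u : 'rV[R]_n,
    (forall i : 'I_n, val i != 0%N -> (u *m P) 0 i = 0) <->
    exists t, u = t *: w.
Proof.
move=> w0; pose P := invmx (row_ebase w).
have Pu : P \in unitmx by rewrite unitmx_inv row_ebase_unit.
have wP i : val i != 0%N -> (w *m P) 0 i = 0.
  move=> i0; rewrite -[w in LHS]mulmx_ebase mulmxK ?row_ebase_unit// mxE.
  rewrite big_ord1 !mxE /=; case: eqP => [i00|_]; last by rewrite mulr0.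
  by move: i0; rewrite /= -i00.
exists P => // u; split=> [uP|[t ->] i i0]; last first.
  by rewrite -scalemxAl mxE wP ?mulr0.
have [i0 wPi0] : exists i, (w *m P) 0 i != 0.
  apply/existsP; apply: contraNT w0 => /existsPn wP0.
  rewrite -(mulmxK Pu w); apply/eqP; rewrite (_ : w *m P = 0) ?mul0mx//.
  by apply/rowP => i; rewrite [RHS]mxE; apply/eqP; rewrite -[_ == _]negbK wP0.
have i00 : val i0 = 0%N by apply/eqP; apply: contraNT wPi0 => /wP ->.
exists ((u *m P) 0 i0 / (w *m P) 0 i0); apply: (can_inj (mulmxK Pu)).
apply/rowP => i; rewrite -scalemxAl [RHS]mxE.
have [->|/eqP ii0] := eqVneq i i0; first by rewrite divfK.
have i_neq0 : val i != 0%N.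
  by apply/eqP => iE; apply: ii0; apply: val_inj; rewrite i00.
by rewrite (uP i)// (wP i)// mulr0.
Qed.

(** The segment from [phi x] to [phi y] stays on the line, and the inverse of [phi] carries it to a
    path in the leaf. *)
Lemma segment_path_component m n (M : set 'rV[R]_m) (phi : 'rV[R]_m -> 'rV[R]_n)
    (w x0 : 'rV[R]_n) x y :
  diffeo_on M setT phi ->
  let L := M `&` phi @^-1` [set x0 + t *: w | t in setT] in
  L x -> L y -> path_component R L x y.
Proof.
move=> [g [_ gS gphi phig]] L [Mx [s _ sE]] [My [t _ tE]].
exists (fun a : R => g (phi x + a *: (phi y - phi x))); split.
- apply: continuous_subspaceT => a; apply: continuous_comp; last first.
    exact/differentiable_continuous/(smooth_on_differentiable openT I gS).
  apply: continuousD; first exact: cst_continuous.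
  by apply: continuousZl; exact: cvg_id.
- by rewrite scale0r addr0; have [] := gphi x Mx.
- by rewrite scale1r addrC subrK; have [] := gphi y My.
- move=> a _; have [Mg phigE] := phig (phi x + a *: (phi y - phi x)) I.
  split=> //; rewrite /preimage /= phigE; exists (s + a * (t - s)) => //.
  rewrite -sE -tE opprD addrACA subrr add0r -scalerBl scalerA.
  by rewrite -addrA -scalerDl.
Qed.

(** A single flat chart with domain [M] serves at every point: [phi] followed by the matrix of
    [flattening]. Each plaque is then a whole leaf. *)
Lemma preimage_leaves_foliation m n (M : set 'rV[R]_m)
    (phi : 'rV[R]_m -> 'rV[R]_n) (w : 'rV[R]_n) :
  w != 0 -> diffeo_on M setT phi ->
  curve_foliation n M (preimage_leaves M phi (parallel_lines w)).
Proof.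
move=> w0 phiD; have phiE := diffeo_on_surj phiD; split.
- split.
  + apply/seteqP; split=> [x [_ [l _ <-]] []//|x Mx].
    exists (M `&` phi @^-1` [set phi x + t *: w | t in setT]).
      by exists [set phi x + t *: w | t in setT] => //; exists (phi x).
    by split=> //; exists 0 => //; rewrite scale0r addr0.
  + move=> _ _ [_ [x0 _ <-] <-] [_ [y0 _ <-] <-] [z [[_ [s _ sE]] [_ [t _ tE]]]].
    congr (_ `&` _ @^-1` _).
    (* Two lines with a common point have base points that differ by a multiple of [w]. *)
    have -> : x0 = y0 + (t - s) *: w.
      apply: (addIr (s *: w)); rewrite sE -tE -addrA -scalerDl.
      by rewrite subrK.
    apply/seteqP; split=> [_ [a _ <-]|_ [a _ <-]].
      by exists (t - s + a) => //; rewrite scalerDl addrA.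
    by exists (a - (t - s)) => //; rewrite -addrA -scalerDl addrCA subrr addr0.
  + move=> _ [_ [x0 _ <-] <-] /=.
    have [x Mx xE] : (phi @` M) x0 by rewrite phiE.
    by exists x; split=> //; exists 0 => //; rewrite scale0r addr0.
- by move=> _ [_ [x0 _ <-] <-] x y; exact: segment_path_component.
- move=> p Mp; have [P Pu Pw] := flattening w0.
  have psiD := diffeo_on_mulmxr Pu phiD.
  exists M, (fun x => phi x *m P); split=> //.
    split; first by exists setT; [exact: openT|rewrite setIT].
      by rewrite (diffeo_on_surj psiD); exact: openT.
    by rewrite (diffeo_on_surj psiD).
  move=> _ x [_ [x0 _ <-] <-].
  rewrite setIAC setIid => -[Mx [s _ sE]]; apply/seteqP; split.
    (* Only the endpoint of the path matters: it lies in the leaf, so [phi y - phi x] is a multiple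
       of [w] and [P] annihilates its coordinates beyond the first. *)
    move=> y [c [_ _ c1 cL]]; have [|My [t _ tE]] := cL 1.
      by rewrite ler01 lexx.
    rewrite c1 in My tE; split=> // i i0; apply/eqP; rewrite -subr_eq0.
    have := (Pw (phi y - phi x)).2; rewrite mulmxBl => H.
    have := H _ i i0; rewrite !mxE => ->//; exists (t - s).
    by rewrite -sE -tE opprD addrACA subrr add0r scalerBl.
  move=> y [My yx]; apply: segment_path_component => //.
    by split=> //; exists s.
  have [|t tE] := (Pw (phi y - phi x)).1.
    by move=> i i0; move: (yx i i0); rewrite mulmxBl !mxE => ->; rewrite subrr.
  split=> //; exists (s + t) => //.
  by rewrite scalerDl addrA sE -tE addrC subrK.
Qed.

(** Leaves are path-connected and contained in [M], so the component of a trace is the whole leaf;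
    leaves are nonempty, so each of them occurs. *)
Lemma restrict_leaves_foliation m n (M : set 'rV[R]_m) (F : set (set 'rV[R]_m)) :
  curve_foliation n M F -> restrict_leaves F M = F.
Proof.
move=> [[FM _ F0] Fc _].
have LM L : F L -> L `&` M = L.
  by move=> FL; apply: setIidl => x Lx; rewrite -FM; exists L.
have pcE L x : F L -> L x -> path_component R L x = L.
  move=> FL Lx; apply/seteqP; split=> [y [c [_ _ <- cL]]|y Ly]; last exact: Fc.
  by apply: cL; rewrite ler01 lexx.
apply/seteqP; split=> [_ [L [x [FL Lx ->]]]|L FL].
  by rewrite LM// in Lx *; rewrite pcE.
by have [x Lx] := F0 L FL; exists L, x; rewrite LM// pcE.
Qed.

(** With the global chart [phi], neither restriction changes the leaves; surjectivity of [phi] makes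
    the image of the preimage of a line the line itself. *)
Lemma preimage_leaves_parallelizable m n d (M : set 'rV[R]_m)
    (phi : 'rV[R]_m -> 'rV[R]_n) (w : 'I_d -> 'rV[R]_n) :
  curve_web n setT (fun k => parallel_lines (w k)) ->
  (forall k, w k != 0) -> diffeo_on M setT phi ->
  parallelizable n M (fun k => preimage_leaves M phi (parallel_lines (w k))).
Proof.
move=> wweb w0 phiD; have phiE := diffeo_on_surj phiD; exists w; split=> // p Mp.
exists M, phi; split=> // [|k].
  by split; rewrite ?phiE//; [exists setT; [exact: openT|rewrite setIT]|exact: openT].
rewrite phiE (restrict_leaves_foliation (wweb.1 k)).
rewrite (restrict_leaves_foliation (preimage_leaves_foliation (w0 k) phiD)).
have imL l : phi @` (M `&` phi @^-1` l) = l.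
  apply/seteqP; split=> [_ [x [_ ?] <-]//|y ly].
  have [x Mx xy] : (phi @` M) y by rewrite phiE.
  by exists x => //; split=> //; rewrite /preimage /= xy.
apply/seteqP; split=> [_ [_ [l ll <-] <-]|l ll]; first by rewrite imL.
by exists (M `&` phi @^-1` l); [exists l|exact: imL].
Qed.

Lemma parallel_lines_foliation n (w : 'rV[R]_n) : w != 0 ->
  curve_foliation n setT (parallel_lines w).
Proof.
move=> w0; have -> : parallel_lines w = preimage_leaves setT id (parallel_lines w).
  rewrite /preimage_leaves (_ : (fun l => _) = id) ?image_id//.
  by apply/funext => l; rewrite setTI.
apply: preimage_leaves_foliation => //.
have idS : smooth_on setT (@id 'rV[R]_n).
  apply: (smooth_on_class_C openT) => // k; apply: class_C_row openT _ => i.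
  exact: class_C_coord.
by exists id.
Qed.

(* A curve in a leaf has locally constant image under [cokermx u], whose kernel is
   the span of [u]. *)
Lemma leaf_tangent_submx m q (F : set (set 'rV[R]_m)) (u : 'M[R]_(q, m)) p v :
  (forall L x, F L -> L p -> L x -> (x - p <= u)%MS) ->
  leaf_tangent F p v -> (v <= u)%MS.
Proof.
move=> Lu [L [e [c [FL e0 cS cL [c0 <-]]]]].
have I0 : - e < 0 < e by rewrite oppr_lt0 e0.
have oI : open [set t : R | - e < t < e].
  have -> : [set t : R | - e < t < e] = `]- e, e[%classic.
    by apply/seteqP; split=> t; rewrite /= in_itv.
  exact: interval_open.
have dc := smooth_on_differentiable oI I0 cS.
rewrite submxE; apply/eqP.
have lc : continuous (mulmxr (cokermx u) : 'rV_m -> 'rV_m).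
  exact: linear_rV_continuous.
have <- : 'D_1 (mulmxr (cokermx u) \o c) 0 = 'D_1 c 0 *m cokermx u.
  exact: derive_linear_comp lc dc.
rewrite (near_eq_derive (g := cst (p *m cokermx u))) ?derive_cst//.
apply: filterS (open_nbhs_nbhs (conj oI I0)) => t It /=.
have : (c t - p <= u)%MS by apply: (Lu L) => //; [rewrite -c0|]; exact: cL.
by rewrite submxE mulmxBl subr_eq0 => /eqP.
Qed.

(** Reduces general position to linear algebra on direction vectors [u]. A nonzero tangent vector is
    a nonzero multiple of [u p k], so a relation between tangent vectors gives one between
    directions with rescaled coefficients. *)
Lemma general_position_directions m n d (M : set 'rV[R]_m)
    (W : 'I_d -> set (set 'rV[R]_m)) (u : 'rV[R]_m -> 'I_d -> 'rV[R]_m) :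
  (forall k p L x, W k L -> L p -> L x -> (x - p <= u p k)%MS) ->
  (forall p r (s : 'I_r -> 'I_d) (a : 'I_r -> R), M p -> (r <= n)%N ->
    injective s -> \sum_i a i *: u p (s i) = 0 -> forall i, a i = 0) ->
  general_position n M W.
Proof.
move=> Wu ufree p v Mp vW r s rn s_inj.
have /choice[b vE] : forall k, exists b, v k = b *: u p k.
  move=> k; apply/sub_rVP; apply: leaf_tangent_submx (vW k).1 => L x.
  exact: Wu.
apply: inj_row_free => a a0.
have ab0 : \sum_i (a 0 i * b (s i)) *: u p (s i) = 0.
  move: a0; rewrite mulmx_sum_row => {2}<-; apply: eq_bigr => i _.
  by rewrite rowK vE scalerA.
apply/rowP => i; rewrite mxE; have /eqP := ufree _ _ _ _ Mp rn s_inj ab0 i.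
rewrite mulf_eq0 => /orP[/eqP//|/eqP b0].
by have := (vW (s i)).2; rewrite vE b0 scale0r eqxx.
Qed.

End Foliations.

(** * Log-ratio coordinates and Cevians of the simplex *)

Section Simplex.
Variables (R : realType) (n : nat).
Implicit Types (p q x : 'rV[R]_n.+1) (y : 'rV[R]_n) (k : 'I_n.+1).

Local Notation M := (open_simplex R n).

(** Linear coordinates on the quotient of R^(n+1) by the line of constant vectors. *)
Definition contrast x : 'rV[R]_n := \row_j (x 0 (lift ord0 j) - x 0 ord0).

Fact contrast_is_linear : linear contrast.
Proof.
by move=> a x z; apply/rowP => j; rewrite !mxE mulrBr opprD addrACA.
Qed.

HB.instance Definition _ := GRing.isLinear.Build R 'rV[R]_n.+1 'rV[R]_n _
  contrast contrast_is_linear.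

Lemma contrast_eq0 x : contrast x = 0 <-> exists c, x = const_mx c.
Proof.
split=> [/rowP x0|[c ->]]; last by apply/rowP => j; rewrite !mxE subrr.
exists (x 0 ord0); apply/rowP => i; rewrite mxE.
case: (unliftP ord0 i) => [j ->|->//].
by apply/eqP; rewrite -subr_eq0; have := x0 j; rewrite !mxE => ->.
Qed.

Definition logratio p : 'rV[R]_n := contrast (map_mx (@ln R) p).

(** The default value 0 gives the reference index [ord0] the weight 1, in accordance with its
    log-ratio to itself. *)
Definition softmax_weight y (i : 'I_n.+1) : R :=
  expR (oapp (y 0) 0 (unlift ord0 i)).

Definition softmax y : 'rV[R]_n.+1 :=
  \row_i (softmax_weight y i / \sum_j softmax_weight y j).

Lemma softmax_weight_gt0 y i : 0 < softmax_weight y i.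
Proof. exact: expR_gt0. Qed.

Lemma softmax_weight_sum_gt0 y : 0 < \sum_j softmax_weight y j.
Proof.
rewrite big_ord_recl ltr_pwDl ?softmax_weight_gt0// sumr_ge0// => j _.
exact/ltW/softmax_weight_gt0.
Qed.

Lemma softmax_simplex y : M (softmax y).
Proof.
split=> [j|]; first by rewrite mxE divr_gt0 ?softmax_weight_gt0 ?softmax_weight_sum_gt0.
under eq_bigr do rewrite mxE.
by rewrite -mulr_suml divff// gt_eqF// softmax_weight_sum_gt0.
Qed.

Lemma softmaxK : cancel softmax logratio.
Proof.
move=> y; apply/rowP => j; rewrite !mxE.
rewrite !ln_div ?posrE ?softmax_weight_gt0 ?softmax_weight_sum_gt0//.
by rewrite opprB subrKA /softmax_weight !expRK liftK unlift_none subr0.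
Qed.

Lemma logratioK p : M p -> softmax (logratio p) = p.
Proof.
move=> [p0 p1].
(* The weights recover [p] up to the factor 1/p_0, which is also their sum since [p] has total mass
   1; normalizing removes it. *)
have wE i : softmax_weight (logratio p) i = p 0 i / p 0 ord0.
  rewrite /softmax_weight; case: (unliftP ord0 i) => [j ->|->] /=.
    by rewrite !mxE expRB !lnK ?posrE.
  by rewrite expR0 divff ?gt_eqF.
apply/rowP => i; rewrite mxE; under eq_bigr do rewrite wE.
by rewrite wE -mulr_suml p1 mul1r invrK divfK ?gt_eqF.
Qed.

(** The simplex is not open in R^(n+1); this is the ambient open set on which [logratio] is shown to
    be smooth. *)
Lemma positive_orthant_open : open [set p : 'rV[R]_n.+1 | forall j, 0 < p 0 j].
Proof.
have coord_gt0_open j : open ((fun p => p 0 j) @^-1` [set a : R | 0 < a]).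
  by apply: open_comp (@open_gt R 0) => p _; exact: coord_continuous.
rewrite openE => p p0.
apply: (@filter_forall _ _ (fun j (q : 'rV[R]_n.+1) => 0 < q 0 j) (nbhs p)) => j.
exact: open_nbhs_nbhs (conj (coord_gt0_open j) (p0 j)).
Qed.

Lemma logratio_diffeo : diffeo_on M setT logratio.
Proof.
exists softmax; split.
- apply: (smooth_on_class_C positive_orthant_open) => [p []//|k].
  have oO := positive_orthant_open.
  apply: class_C_row => // j.
  have lnC i : class_C k [set p : 'rV[R]_n.+1 | forall j, 0 < p 0 j] (@ln R \o (fun p => p 0 i)).
    by apply: class_C_ln => //; exact: class_C_coord.
  have -> : (fun p => logratio p 0 j) = (@ln R \o (fun p => p 0 (lift ord0 j))) \+
      ((cst (-1)) \* (@ln R \o (fun p => p 0 ord0))).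
    by apply/funext => p; rewrite /= !mxE mulN1r.
  by apply: class_CD => //; apply: class_CM => //; exact: class_C_cst.
- apply: (smooth_on_class_C openT) => // k; apply: class_C_row => [|i]; first exact: openT.
  have wC j : class_C k setT (fun y => softmax_weight y j).
    apply: (class_C_expR (f := fun y => oapp (y 0) 0 (unlift ord0 j)) openT).
    by case: unlift => [l|] /=; [exact: class_C_coord|exact: class_C_cst].
  have -> : (fun y => softmax y 0 i) = (fun y => softmax_weight y i) \*
      (GRing.inv \o (fun y => \sum_j softmax_weight y j)).
    by apply/funext => y; rewrite mxE.
  apply: class_CM => //; first exact: openT.
  apply: class_CV => [|y _|]; first exact: openT.
    by rewrite gt_eqF// softmax_weight_sum_gt0.
  by apply: class_C_sum => //; exact: openT.
- by move=> p Mp; split=> //; exact: logratioK.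
- by move=> y _; split; [exact: softmax_simplex|exact: softmaxK].
Qed.

Lemma logratio_lineP k p x : M p -> M x ->
  (exists t, logratio x = logratio p + t *: contrast (vertex R k)) <->
  exists2 a, 0 < a & forall i, i != k -> x 0 i = a * p 0 i.
Proof.
move=> [p0 _] [x0 _].
have lineE t : logratio x = logratio p + t *: contrast (vertex R k) <->
    exists c, map_mx (@ln R) x - map_mx (@ln R) p - t *: vertex R k = const_mx c.
  rewrite -contrast_eq0 !linearB/= linearZ/= -addrA -opprD -!/(logratio _).
  by split=> [->|/subr0_eq//]; rewrite subrr.
split=> [[t /lineE[c /rowP cE]]|[a a0 xE]].
  (* Off [k] the vertex vanishes, so ln x_i - ln p_i is the constant c. *)
  exists (expR c) => [|i /negPf ik]; first exact: expR_gt0.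
  have := cE i; rewrite !mxE ik /= mulr0 subr0 => <-.
  by rewrite expRB !lnK ?posrE// divfK ?gt_eqF.
(* With the constant ln a imposed by the other coordinates, the k-th one determines t. *)
exists (ln (x 0 k) - ln (p 0 k) - ln a); apply/lineE; exists (ln a).
apply/rowP => i; rewrite !mxE; have [->|ik] := eqVneq i k.
  by rewrite mulr1 subKr.
by rewrite mulr0 subr0 xE// lnM ?posrE// addrK.
Qed.

Hypothesis n_gt0 : (0 < n)%N.

(** Another index, [lift k (Ordinal n_gt0)], carries positive mass. This permits division by 1 - p_k
    when projecting from the vertex. *)
Lemma simplex_coord_lt1 k p : M p -> p 0 k < 1.
Proof.
move=> [p0 <-]; have kl : lift k (Ordinal n_gt0) != k by rewrite eq_sym neq_lift.
rewrite (bigD1 k)//= (bigD1 (lift k (Ordinal n_gt0)))//= ltrDl.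
by rewrite ltr_pwDl// sumr_ge0// => j _; exact: ltW.
Qed.

Lemma simplex_sumC k p : M p -> \sum_(i | i != k) p 0 i = 1 - p 0 k.
Proof. by move=> [_ <-]; rewrite [in RHS](bigD1 k)//= addrAC subrr add0r. Qed.

Lemma cevian_coord k q t i :
  ((1 - t) *: vertex R k + t *: q) 0 i = (1 - t) *+ (i == k) + t * q 0 i.
Proof. by rewrite !mxE /= mulr_natr. Qed.

(** A point z of the Cevian has parameter 1 - z_k, and off [k] its coordinates are this parameter
    times those of [q]. Hence the ratio [a] of two points is the ratio of their parameters. *)
Lemma cevianP k q p x : opposite_face k q -> cevian k q p -> M p -> M x ->
  cevian k q x <-> exists2 a, 0 < a & forall i, i != k -> x 0 i = a * p 0 i.
Proof.
move=> [_ _ qk] [s _ sE] Mp Mx.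
have off_k z t : (1 - t) *: vertex R k + t *: q = z ->
    (forall i, i != k -> z 0 i = t * q 0 i) /\ t = 1 - z 0 k.
  move=> <-; split=> [i /negPf ik|]; first by rewrite cevian_coord ik add0r.
  by rewrite cevian_coord eqxx qk mulr0 addr0 subKr.
have [pE spk] := off_k _ _ sE.
have s0 : 0 < s by rewrite spk subr_gt0 simplex_coord_lt1.
split=> [[t _ /off_k[xE txk]]|[a a0 xE]].
  have t0 : 0 < t by rewrite txk subr_gt0 simplex_coord_lt1.
  exists (t / s) => [|i ik]; first exact: divr_gt0.
  by rewrite xE// pE// mulrA divfK ?gt_eqF.
(* Summing the proportionality over the indices other than [k] shows that [a * s] is the parameter
   which [x] must have; in particular it is at most 1. *)
have asE : a * s = 1 - x 0 k.
  rewrite -(simplex_sumC k Mx) spk -(simplex_sumC k Mp) mulr_sumr.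
  by apply: eq_bigr => i ik; rewrite xE.
exists (a * s) => [/=|].
  rewrite (ltW (mulr_gt0 a0 s0)) asE gerBl.
  by apply: ltW; case: Mx.
apply/rowP => i; rewrite cevian_coord; have [->|ik] := eqVneq i k.
  by rewrite qk mulr0 addr0 asE subKr.
by rewrite add0r xE// pE// mulrA.
Qed.

Lemma cevian_through k p : M p -> exists2 q, opposite_face k q & cevian k q p.
Proof.
move=> Mp; have pk1 := simplex_coord_lt1 k Mp; have [p0 _] := Mp.
have pk0 : 1 - p 0 k != 0 by rewrite gt_eqF// subr_gt0.
(* Projection of [p] from the vertex: dividing by 1 - p_k restores total mass 1 once the k-th
   coordinate is dropped. *)
pose q : 'rV[R]_n.+1 := \row_i (if i == k then 0 else p 0 i / (1 - p 0 k)).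
exists q.
  split=> [j||]; last by rewrite mxE eqxx.
    by rewrite mxE; case: ifP => // _; rewrite divr_ge0 ?ltW// subr_gt0.
  rewrite (bigD1 k)//= mxE eqxx add0r.
  under eq_bigr => i /negPf ik do rewrite mxE ik.
  by rewrite -mulr_suml simplex_sumC// divff.
exists (1 - p 0 k) => [/=|].
  by rewrite subr_ge0 ltW//= lerBlDr lerDl ltW.
apply/rowP => i; rewrite cevian_coord mxE; have [->|ik] := eqVneq i k.
  by rewrite mulr0 addr0 subKr.
by rewrite add0r mulrC divfK.
Qed.

(** Both kinds of leaves through a point are described by proportionality off [k], by [cevianP] and
    [logratio_lineP]. *)
Lemma cevian_leavesE k : cevian_leaves R n k =
  preimage_leaves M logratio (parallel_lines (contrast (vertex R k))).
Proof.
have lineE q p : opposite_face k q -> cevian k q p -> M p ->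
    cevian k q `&` M = M `&` logratio @^-1`
      [set logratio p + t *: contrast (vertex R k) | t in setT].
  move=> qF qp Mp; rewrite setIC; apply/seteqP; split=> x [Mx xL]; split=> //.
    have [|t tE] := (logratio_lineP k Mp Mx).2; first exact/(cevianP qF qp Mp Mx).
    by exists t.
  apply/(cevianP qF qp Mp Mx)/(logratio_lineP k Mp Mx).
  by case: xL => t _ tE; exists t.
apply/seteqP; split=> [L [[p Lp] [q qF LE]]|_ [_ [y _ <-] <-]].
  rewrite LE in Lp *; have [qp Mp] := Lp; rewrite (lineE q p)//.
  exists [set logratio p + t *: contrast (vertex R k) | t in setT] => //.
  by exists (logratio p).
(* The line with base point [y] is the image of the Cevian through [softmax y]. *)
have Mp := softmax_simplex y; have [q qF qp] := cevian_through k Mp.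
rewrite -[y]softmaxK -(lineE q)//; split; last by exists q.
by exists (softmax y).
Qed.

Lemma cevian_leaf_direction k p L x : cevian_leaves R n k L -> L p -> L x ->
  (x - p <= vertex R k - p)%MS.
Proof.
move=> [_ [q qF ->]] [qp Mp] [qx Mx].
have [a _ xE] := (cevianP qF qp Mp Mx).1 qx.
(* In fact x = a p + (1 - a) e_k: off [k] by proportionality, at [k] because both points have total
   mass 1. *)
apply/sub_rVP; exists (1 - a); apply/rowP => i; rewrite !mxE /=.
have [->|ik] := eqVneq i k; last first.
  by rewrite xE// sub0r mulrN -mulNr opprB mulrBl mul1r.
have : 1 - x 0 k = a * (1 - p 0 k).
  rewrite -(simplex_sumC k Mx) -(simplex_sumC k Mp) mulr_sumr.
  by apply: eq_bigr => i' ik; rewrite xE.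
by rewrite mulrBl mul1r => <-; rewrite opprB [RHS]addrC subrKA.
Qed.

(* As [r <= n], some vertex is missing from [s]; its coordinate forces [c = 0].
   Taking [q] interior gives the independence of the directions of the Cevians at
   [q], taking [q] constant that of their images under [contrast]. *)
Lemma vertices_affinely_free r (s : 'I_r -> 'I_n.+1) (a : 'I_r -> R) c q :
  (r <= n)%N -> injective s -> (forall j, q 0 j != 0) ->
  \sum_i a i *: vertex R (s i) = c *: q -> forall i, a i = 0.
Proof.
move=> rn s_inj q0 aE.
have aEj j : \sum_i a i * (j == s i)%:R = c * q 0 j.
  have /rowP/(_ j) := aE; rewrite summxE !mxE => <-.
  by apply: eq_bigr => i _; rewrite !mxE.
have [j js] : exists j, j \notin codom s.
  apply/existsP; apply: contraLR rn => /existsPn js; rewrite -ltnNge.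
  have : {subset 'I_n.+1 <= codom s} by move=> j _; have := js j; rewrite negbK.
  move=> /fintype.subsetP/subset_leq_card; rewrite card_ord (card_codom s_inj).
  by rewrite card_ord.
have c0 : c = 0.
  have := aEj j; rewrite big1 => [/esym/eqP|i _].
    by rewrite mulf_eq0 (negPf (q0 j)) orbF => /eqP.
  case: eqP => [ji|]; last by rewrite mulr0.
  by rewrite ji codom_f in js.
move=> i; have := aEj (s i); rewrite c0 mul0r (bigD1 i)//= eqxx mulr1.
rewrite big1 ?addr0// => l li; case: eqP => [/s_inj il|]; last by rewrite mulr0.
by rewrite il eqxx in li.
Qed.

End Simplex.

(** * Independence of the directions, and the Cevian web *)

Theorem proposition5 (R : realType) (n : nat) (hn : (2 <= n)%N) :
  exists W : 'I_n.+1 -> set (set 'rV[R]_n.+1),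
    [/\ curve_web n (open_simplex R n) W,
        parallelizable n (open_simplex R n) W
      & forall k : 'I_n.+1, W k = cevian_leaves R n k].
Proof.
have n0 : (0 < n)%N by exact: ltnW.
have phiD := logratio_diffeo R n.
pose w k := contrast (vertex R (k : 'I_n.+1)).
have wfree r (s : 'I_r -> 'I_n.+1) (a : 'I_r -> R) : (r <= n)%N -> injective s ->
    \sum_i a i *: w (s i) = 0 -> forall i, a i = 0.
  (* A relation between the images under [contrast] lifts to a combination of vertices lying in the
     kernel, that is, equal to a multiple of (1, ..., 1). *)
  move=> rn s_inj a0; pose v := \sum_i a i *: vertex R (s i).
  have [c vE] : exists c, v = const_mx c.
    apply/contrast_eq0; rewrite -[RHS]a0 linear_sum.
    by apply: eq_bigr => i _; rewrite linearZ.
  apply: (@vertices_affinely_free _ _ _ _ _ c (const_mx 1)) rn s_inj _ _ => //.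
    by move=> j; rewrite mxE oner_neq0.
  by rewrite -/v vE; apply/rowP => j; rewrite !mxE mulr1.
have w0 k : w k != 0.
  apply/eqP => wk0; suff /eqP : 1 = 0 :> R by rewrite oner_eq0.
  (* A zero direction would be a nontrivial relation of length 1. *)
  apply: (wfree 1%N (fun=> k) (fun=> 1)) ord0 => // [i j _|].
    by rewrite !ord1.
  by rewrite big1// => i _; rewrite wk0 scaler0.
have linesW : curve_web n setT (fun k => parallel_lines (w k)).
  split=> [k|]; first exact: parallel_lines_foliation.
  apply: (general_position_directions (u := fun _ => w)) => [k p L x|p r s a _].
    move=> [x0 _ <-] [s _ <-] [t _ <-]; apply/sub_rVP; exists (t - s).
    by rewrite opprD addrACA subrr add0r scalerBl.
  exact: wfree.
exists (cevian_leaves R n).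
have -> : cevian_leaves R n =
    fun k => preimage_leaves (open_simplex R n) (@logratio R n) (parallel_lines (w k)).
  by apply/funext => k; exact: cevian_leavesE.
split=> //; last exact: preimage_leaves_parallelizable.
split=> [k|]; first exact: preimage_leaves_foliation.
apply: (general_position_directions (u := fun p k => vertex R k - p)).
  move=> k p L x; rewrite -cevian_leavesE//; exact: cevian_leaf_direction.
move=> p r s a [p0 _] rn s_inj a0.
(* A relation between the vectors e_(s i) - p equates a combination of vertices with (sum of the
   a_i) p, and [p] has no zero coordinate. *)
apply: (@vertices_affinely_free _ _ _ _ _ (\sum_i a i) p) rn s_inj _ _.
  by move=> j; rewrite gt_eqF.
apply/eqP; rewrite -subr_eq0 scaler_suml -sumrB -[X in _ == X]a0; apply/eqP.
by apply: eq_bigr => i _; rewrite scalerBr.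
Qed.
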